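(* Let $n\ge 3$ be an integer and let $Sp(2^{[n]})$ be the spider graph with $n$ legs, each of length $2$. Then $$\chi_{lat}(Sp(2^{[n]})) = \begin{cases} 2 & \text{if } n\le 9,\\ 3 & \text{otherwise.}\end{cases}$$
   Context: All graphs are finite, simple and loopless. For integers $a<b$, $[a,b]=\{a,a+1,\ldots,b\}$. Let $G=(V,E)$ be a connected graph with $p$ vertices and $q$ edges. For a bijection $f:V(G)\cup E(G)\to[1,p+q]$, the weight of a vertex $u$ is $w(u)=f(u)+\sum_{e\in E(u)} f(e)$, where $E(u)$ is the set of edges incident to $u$. The bijection $f$ is a local antimagic total labeling of $G$ if $w(u)\ne w(v)$ for every pair of adjacent vertices $u,v$. The local antimagic total chromatic number $\chi_{lat}(G)$ is the minimum, over all local antimagic total labelings $f$ of $G$, of the number of distinct vertex weights $w(u)$, $u\in V(G)$, induced by $f$. The spider $Sp(2^{[n]})$ is the tree obtained from $n$ paths of length $2$ (each with two edges) by identifying one end-vertex from each of them into a single vertex. Explicitly, it has vertex set $\{x,u_i,v_i : 1\le i\le n\}$ and edge set $\{xu_i,u_iv_i : 1\le i\le n\}$. *)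

(* Defs.v *)
From mathcomp Require Import all_boot.

Set Implicit Arguments.
Unset Strict Implicit.
Unset Printing Implicit Defensive.

Record cgraph := CGraph {
  vertex :> finType;
  adj : rel vertex;
  adj_sym : symmetric adj;
  adj_irr : irreflexive adj;
  adj_conn : forall x y : vertex, connect adj x y
}.

Definition edges (G : cgraph) : {set {set G}} :=
  [set e | [exists x : G, exists y : G, adj x y && (e == [set x; y])]].

Definition edge (G : cgraph) : finType := {e : {set G} | e \in edges G}.

(* p + q *)
Definition nlabels (G : cgraph) : nat := #|G| + #|edges G|.

(* 'I_(nlabels G).+1 is {0, ..., p + q}; the value 0 is excluded by
   [label_bij] below. *)
Definition labeling (G : cgraph) : finType :=
  {ffun G + edge G -> 'I_(nlabels G).+1}.

(* f is a bijection from V + E onto [1, p + q]. *)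
Definition label_bij (G : cgraph) (f : labeling G) : bool :=
  injectiveb f && (f @: setT == [set k : 'I_(nlabels G).+1 | 1 <= k]).

Definition weight (G : cgraph) (f : labeling G) (u : G) : nat :=
  f (inl u) + \sum_(e : edge G | u \in val e) f (inr e).

Definition local_antimagic_total (G : cgraph) (f : labeling G) : bool :=
  label_bij f &&
  [forall u : G, forall v : G, adj u v ==> (weight f u != weight f v)].

Definition num_weights (G : cgraph) (f : labeling G) : nat :=
  size (undup [seq weight f u | u : G]).

Definition lat_colors (G : cgraph) (k : nat) : bool :=
  [exists f : labeling G, local_antimagic_total f && (num_weights f == k)].

(* Label the edges with 1, ..., q arbitrarily, then label the vertices with
   q + 1, ..., q + p in nondecreasing order of the sum of their edge labels. *)
Lemma lat_colors_exists (G : cgraph) : exists k, lat_colors G k.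
Proof.
have cE : #|edge G| = #|edges G| by rewrite /edge card_sig; apply: eq_card.
pose el (e : edge G) := (enum_rank e).+1.
pose s (u : G) := \sum_(e : edge G | u \in val e) el e.
pose le := [rel a b : G | s a <= s b].
have le_tot : total le by move=> a b; exact: leq_total.
have le_tr : transitive le by move=> b a c; exact: leq_trans.
pose r := sort le (enum G).
have mem_r u : u \in r by rewrite mem_sort mem_enum.
have size_r : size r = #|G| by rewrite size_sort -cardE.
have idx_lt u : index u r < #|G| by rewrite -size_r index_mem.
pose g (z : G + edge G) : nat :=
  match z with inl u => #|edges G| + (index u r).+1 | inr e => el e end.
have el_le e : el e <= #|edges G| by rewrite -cE; exact: ltn_ord.
have g_le z : g z < (nlabels G).+1.
  case: z => [u|e] /=; rewrite ltnS /nlabels.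
    by rewrite addnC leq_add2r idx_lt.
  by rewrite (leq_trans (el_le e)) // leq_addl.
have g_inj : injective g.
  move=> [u|e] [v|e'] /=.
  - move=> /addnI[h]; congr inl.
    by apply: (index_inj u (mem_r u) (mem_r v)); exact: h.
  - by move=> h; have := el_le e'; rewrite -h addnS ltnNge leq_addr.
  - by move=> h; have := el_le e; rewrite h addnS ltnNge leq_addr.
  - by move=> [] h; congr inr; apply/enum_rank_inj/val_inj.
pose f : labeling G := [ffun z => Ordinal (g_le z)].
have fE z : f z = g z :> nat by rewrite ffunE.
have f_inj : injective f.
  by move=> z t /(congr1 val) /=; rewrite !fE => /g_inj.
have wE u : weight f u = g (inl u) + s u.
  by rewrite /weight fE; congr (_ + _); apply: eq_bigr => e _; rewrite fE.
have w_lt u v : index u r < index v r -> weight f u < weight f v.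
  move=> h; rewrite !wE /= -addSn; apply: leq_add.
    by rewrite -addnS leq_add2l ltnS.
  have r_sorted : sorted le r by exact: sort_sorted.
  have := sorted_ltn_nth le_tr u r_sorted (index u r) (index v r).
  by rewrite !inE !index_mem !mem_r !nth_index ?mem_r // => /(_ isT isT h).
exists (num_weights f); apply/existsP; exists f; rewrite eqxx andbT.
apply/andP; split; last first.
  apply/forallP => u; apply/forallP => v; apply/implyP => uv.
  case: (ltngtP (index u r) (index v r)) => [/w_lt | /w_lt | h].
  - by rewrite ltn_neqAle => /andP[].
  - by rewrite ltn_neqAle eq_sym => /andP[].
  by move: uv; rewrite (index_inj u (mem_r u) (mem_r v) h) adj_irr.
apply/andP; split; first exact/injectiveP.
rewrite eqEcard; apply/andP; split.
  apply/subsetP => k /imsetP[z _ ->]; rewrite inE fE.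
  by case: z => [u|e] //=; rewrite addnS.
rewrite card_imset // cardsT card_sum cE.
have -> : [set k : 'I_(nlabels G).+1 | 1 <= k] = [set~ ord0].
  by apply/setP => k; rewrite !inE lt0n.
by rewrite cardsC1 card_ord.
Qed.

Definition chi_lat (G : cgraph) : nat := ex_minn (lat_colors_exists G).

(* None is x, Some (inl i) is u_i and Some (inr i) is v_i. *)
Definition spider_vertex (n : nat) : finType := option ('I_n + 'I_n).

Definition spider_arc (n : nat) (a b : spider_vertex n) : bool :=
  match a, b with
  | None, Some (inl _) => true
  | Some (inl i), Some (inr j) => i == j
  | _, _ => false
  end.

Definition spider_adj (n : nat) : rel (spider_vertex n) :=
  fun a b => spider_arc a b || spider_arc b a.

Lemma spider_adj_sym (n : nat) : symmetric (@spider_adj n).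
Proof. by move=> a b; rewrite /spider_adj orbC. Qed.

Lemma spider_adj_irr (n : nat) : irreflexive (@spider_adj n).
Proof. by case=> [[i|i]|]. Qed.

Lemma spider_adj_conn (n : nat) (a b : spider_vertex n) :
  connect (@spider_adj n) a b.
Proof.
have cs := sym_connect_sym (@spider_adj_sym n).
have u_conn (i : 'I_n) : connect (@spider_adj n) None (Some (inl i)).
  exact: connect1.
have x_conn c : connect (@spider_adj n) None c.
  case: c => [[i|i]|]; [exact: u_conn | | exact: connect0].
  apply: connect_trans (u_conn i) _; apply: connect1.
  by rewrite /spider_adj /= eqxx.
by apply: connect_trans (x_conn b); rewrite cs.
Qed.

(* Sp(2^[n]) *)
Definition spider2 (n : nat) : cgraph :=
  CGraph (@spider_adj_sym n) (@spider_adj_irr n) (@spider_adj_conn n).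

(* Main.v *)
Require Import Defs.
From mathcomp Require Import all_boot.
From mathcomp Require Import zify.

(** Write a_i, e_i, b_i, d_i for the labels of the edges x u_i and u_i v_i and
    of the vertices u_i and v_i, and c for the label of x. The weights are
    w(x) = c + sum a_i, w(u_i) = a_i + b_i + e_i and w(v_i) = e_i + d_i.

    Adjacent vertices have different weights, so there are at least two.
    Suppose that there are exactly two. Along a leg, x and v_i both differ from
    u_i in weight, so all v_i have the weight B of x. Squeeze B between two
    estimates. It is the sum of the n + 1 distinct positive numbers c, a_i, so
    B >= (n + 1)(n + 2) / 2. On the other hand n B is the sum of the 2n
    distinct labels e_i, d_i, all at most 4n + 1, so n B <= n (6n + 3). These
    two bounds are compatible exactly when n <= 9 ([chi_lat_spider_ge3]); both
    are instances of [sum_distinct_ge].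

    Conversely, for 3 <= n <= 9 explicit labelings with two weights are given
    ([chi_lat_spider_le2]). With one more weight allowed, w(x) is free, and it
    remains to make a_i + b_i + e_i and e_i + d_i constant. This is done with
    intervals of labels: e_i takes the values 1, ..., n, so that b_i + a_i has
    to run through n consecutive integers in the opposite order; a zigzag
    pairing of two intervals achieves this ([chi_lat_spider_le3]). *)

Set Implicit Arguments.
Unset Strict Implicit.
Unset Printing Implicit Defensive.

(** * Number of weights of a labeling *)

Lemma mem_weights (G : cgraph) (f : labeling G) (u : G) :
  weight f u \in undup [seq weight f u | u : G].
Proof. by rewrite mem_undup; apply: image_f. Qed.

(** Every lower bound on [chi_lat] is obtained from two or three vertices whose
    weights have to differ. *)
Lemma num_weights_ge (G : cgraph) (f : labeling G) (us : seq G) :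
  uniq [seq weight f u | u <- us] -> size us <= num_weights f.
Proof.
move=> us_uniq; rewrite -(size_map (weight f)); apply: uniq_leq_size => //.
by move=> _ /mapP[u _ ->]; exact: mem_weights.
Qed.

Lemma num_weights_le (G : cgraph) (f : labeling G) (ws : seq nat) :
  (forall u, weight f u \in ws) -> num_weights f <= size (undup ws).
Proof.
move=> ws_f; apply: uniq_leq_size; first exact: undup_uniq.
by move=> k; rewrite !mem_undup => /mapP[u _ ->].
Qed.

Lemma chi_lat_le (G : cgraph) (f : labeling G) :
  local_antimagic_total f -> chi_lat G <= num_weights f.
Proof.
move=> f_lat; rewrite /chi_lat; case: ex_minnP => k _; apply.
by apply/existsP; exists f; rewrite f_lat eqxx.
Qed.

Lemma chi_lat_ge (G : cgraph) (k : nat) :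
  (forall f : labeling G, local_antimagic_total f -> k <= num_weights f) ->
  k <= chi_lat G.
Proof.
move=> k_le; rewrite /chi_lat; case: ex_minnP => m + _.
by case/existsP=> f /andP[/k_le f_ge /eqP <-].
Qed.

Lemma weight_adj (G : cgraph) (f : labeling G) (u v : G) :
  local_antimagic_total f -> adj u v -> weight f u != weight f v.
Proof. by case/andP=> _ /forallP/(_ u)/forallP/(_ v)/implyP. Qed.

Lemma label_inj (G : cgraph) (f : labeling G) :
  local_antimagic_total f -> injective (fun z => val (f z)).
Proof.
by case/andP=> /andP[/injectiveP f_inj _] _ x y /val_inj /f_inj.
Qed.

Lemma label_gt0 (G : cgraph) (f : labeling G) z :
  local_antimagic_total f -> 0 < f z.
Proof.
case/andP=> /andP[_ /eqP f_im] _.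
by have := imset_f f (in_setT z); rewrite f_im inE.
Qed.

(** * Edges and weights of the spider *)

Section Spider.

Variable n : nat.
Local Notation G := (spider2 n).

(** The two edges of each leg are indexed by ['I_n + 'I_n]: [inl i] is x u_i and
    [inr i] is u_i v_i. *)
Definition leg_edge_set (s : 'I_n + 'I_n) : {set G} :=
  match s with
  | inl i => [set None; Some (inl i)]
  | inr i => [set Some (inl i); Some (inr i)]
  end.

Lemma leg_edge_subproof s : leg_edge_set s \in edges G.
Proof.
rewrite inE; case: s => i; apply/existsP.
  by exists None; apply/existsP; exists (Some (inl i)); rewrite eqxx andbT.
exists (Some (inl i)); apply/existsP; exists (Some (inr i)).
by rewrite eqxx andbT /= /spider_adj /= eqxx.
Qed.

Definition leg_edge s : edge G := Sub (leg_edge_set s) (leg_edge_subproof s).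
Definition inner_edge i := leg_edge (inl i).
Definition outer_edge i := leg_edge (inr i).

Lemma leg_edge_inj : injective leg_edge.
Proof.
move=> s t /(congr1 val) /= /setP st; case: s st => i; case: t => j st.
- by have := st (Some (inl i)); rewrite !inE /= eqxx => /esym/eqP[->].
- by have := st None; rewrite !inE.
- by have := st None; rewrite !inE.
- by have := st (Some (inr i)); rewrite !inE /= eqxx => /esym/eqP[->].
Qed.

Lemma leg_edge_surj (e : edge G) : exists s, e = leg_edge s.
Proof.
case: e => E E_edge; have := E_edge.
rewrite inE => /existsP[a /existsP[b /andP[ab /eqP E_ab]]].
suff [s E_s] : exists s, E = leg_edge_set s by exists s; apply: val_inj.
rewrite {}E_ab; case: a b ab => [[i|i]|] [[j|j]|] //=;
  rewrite /spider_adj /= ?orbF.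
- by move=> /eqP ->; exists (inr j).
- by exists (inl i); rewrite setUC.
- by move=> /eqP ->; exists (inr i); rewrite setUC.
- by exists (inl j).
Qed.

Lemma leg_edge_bij : bijective leg_edge.
Proof.
apply: inj_card_bij leg_edge_inj _.
rewrite -(card_codom leg_edge_inj); apply/subset_leq_card/subsetP => e _.
by have [s ->] := leg_edge_surj e; exact: codom_f.
Qed.

Lemma card_spider_edges : #|edges G| = n + n.
Proof.
have <- : #|edge G| = #|edges G| by rewrite /edge card_sig; apply: eq_card.
by rewrite -(bij_eq_card leg_edge_bij) card_sum card_ord.
Qed.

Lemma nlabels_spider : nlabels G = 4 * n + 1.
Proof.
by rewrite /nlabels card_spider_edges /= card_option card_sum card_ord; lia.
Qed.

Lemma sum_edges (F : edge G -> nat) (u : G) :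
  \sum_(e : edge G | u \in val e) F e =
  \sum_(i | u \in leg_edge_set (inl i)) F (inner_edge i) +
  \sum_(i | u \in leg_edge_set (inr i)) F (outer_edge i).
Proof.
rewrite (reindex leg_edge) ?big_sumType //=.
exact/onW_bij/leg_edge_bij.
Qed.

Section Weights.

Variable f : labeling G.

Lemma weight_center :
  weight f None = f (inl None) + \sum_i f (inr (inner_edge i)).
Proof.
rewrite /weight sum_edges [X in _ + (_ + X)]big_pred0 ?addn0.
  by congr (_ + _); apply: eq_bigl => i; rewrite !inE.
by move=> i; rewrite !inE.
Qed.

Lemma weight_middle i :
  weight f (Some (inl i)) =
  f (inl (Some (inl i))) + (f (inr (inner_edge i)) + f (inr (outer_edge i))).
Proof.
rewrite /weight sum_edges; congr (_ + (_ + _)); apply: big_pred1 => j;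
  by rewrite !inE /= ?orbF eq_sym; apply/eqP/eqP => [[]|->].
Qed.

Lemma weight_leaf i :
  weight f (Some (inr i)) = f (inl (Some (inr i))) + f (inr (outer_edge i)).
Proof.
rewrite /weight sum_edges big_pred0; last by move=> j; rewrite !inE.
rewrite add0n; congr (_ + _); apply: big_pred1 => j.
by rewrite !inE /= eq_sym; apply/eqP/eqP => [[]|->].
Qed.

End Weights.

(** * Labelings from tables *)

Lemma sumn_mkseq (a : nat -> nat) m : sumn (mkseq a m) = \sum_(i < m) a i.
Proof. by rewrite sumnE big_map -[in LHS](subn0 m) big_mkord. Qed.

(** With edges indexed by ['I_n + 'I_n] and labels taken in [nat], a labeling is
    just an injection into [1, p + q]: onto-ness is automatic, since the two
    sides have the same cardinality. *)
Lemma labeling_of_nat (g : G + ('I_n + 'I_n) -> nat) :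
  injective g -> (forall z, 0 < g z <= 4 * n + 1) ->
  exists2 f : labeling G, label_bij f &
    (forall u, f (inl u) = g (inl u) :> nat) /\
    (forall s, f (inr (leg_edge s)) = g (inr s) :> nat).
Proof.
move=> g_inj g_range; have [leg legK legV] := leg_edge_bij.
pose r (z : G + edge G) : G + ('I_n + 'I_n) :=
  match z with inl u => inl u | inr e => inr (leg e) end.
pose h z := g (r z).
have h_lt z : h z < (nlabels G).+1.
  by rewrite nlabels_spider ltnS; case/andP: (g_range (r z)).
pose f : labeling G := [ffun z => Ordinal (h_lt z)].
have fE z : f z = h z :> nat by rewrite ffunE.
have f_inj : injective f.
  move=> z t /(congr1 val); rewrite /= !fE => /g_inj.
  by case: z t => [u|e] [v|e'] // [] => [-> // | /(can_inj legV) ->].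
exists f; last by split=> [u|s]; rewrite fE /h /= ?legK.
rewrite /label_bij; apply/andP; split; first exact/injectiveP.
rewrite eqEcard; apply/andP; split.
  apply/subsetP => k /imsetP[z _ ->]; rewrite inE fE.
  by case/andP: (g_range (r z)).
have -> : [set k : 'I_(nlabels G).+1 | 1 <= k] = [set~ ord0].
  by apply/setP => k; rewrite !inE lt0n.
rewrite cardsC1 card_ord card_imset // cardsT card_sum /= nlabels_spider.
by rewrite -(bij_eq_card leg_edge_bij) card_option !card_sum card_ord; lia.
Qed.

Definition table_labels (c : nat) (a b e d : nat -> nat) : seq nat :=
  c :: mkseq a n ++ mkseq b n ++ mkseq e n ++ mkseq d n.

(** Constant weights on the u_i and on the v_i leave only w(x) as a third value,
    so at most three weights occur, and only two if w(x) = [wv]. *)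
Lemma chi_lat_spider_le (c : nat) (a b e d : nat -> nat) (wu wv : nat) :
  uniq (table_labels c a b e d) ->
  all (fun k => 0 < k <= 4 * n + 1) (table_labels c a b e d) ->
  (forall i, i < n -> a i + b i + e i = wu) ->
  (forall i, i < n -> e i + d i = wv) ->
  wu != wv -> wu != c + sumn (mkseq a n) ->
  chi_lat G <= size (undup [:: c + sumn (mkseq a n); wu; wv]).
Proof.
move=> L_uniq L_range wuE wvE wu_wv wu_wx.
set L := table_labels c a b e d in L_uniq L_range.
(* Turns the uniqueness of L into injectivity of the labeling. *)
pose pos (z : G + ('I_n + 'I_n)) : nat :=
  match z with
  | inl None => 0
  | inr (inl i) => i.+1
  | inl (Some (inl i)) => (n + i).+1
  | inr (inr i) => (2 * n + i).+1
  | inl (Some (inr i)) => (3 * n + i).+1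
  end.
have size_L : size L = 4 * n + 1.
  by rewrite /L /= !size_cat !size_mkseq; lia.
have pos_lt z : pos z < size L.
  by rewrite size_L; case: z => [[[i|i]|]|[i|i]] /=; try have := ltn_ord i; lia.
have pos_inj : injective pos.
  move=> [[[i|i]|]|[i|i]] [[[j|j]|]|[j|j]] //= [] H;
    try (have := ltn_ord i; have := ltn_ord j; lia);
    by have -> : i = j by apply: val_inj => /=; lia.
pose g z := nth 0 L (pos z).
have g_inj : injective g.
  by move=> z t /eqP; rewrite nth_uniq // => /eqP/pos_inj.
have g_range z : 0 < g z <= 4 * n + 1.
  by apply: (allP L_range); apply: mem_nth.
have gN : g (inl None) = c by [].
have nth_head t l (i : 'I_n) : nth 0 (mkseq t n ++ l) i = t i.
  by rewrite nth_cat size_mkseq ltn_ord nth_mkseq.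
have nth_tail t l i : nth 0 (mkseq t n ++ l) (n + i) = nth 0 l i.
  by rewrite nth_cat size_mkseq ltnNge leq_addr addKn.
have ga i : g (inr (inl i)) = a i by rewrite /g /= nth_head.
have gb i : g (inl (Some (inl i))) = b i by rewrite /g /= nth_tail nth_head.
have ge i : g (inr (inr i)) = e i.
  by rewrite /g /= mul2n -addnn -addnA !nth_tail nth_head.
have gd i : g (inl (Some (inr i))) = d i.
  rewrite /g /= (_ : 3 * n + i = n + (n + (n + i))); last by lia.
  by rewrite !nth_tail nth_mkseq.
have [f f_bij [f_vert f_edge]] := labeling_of_nat g_inj g_range.
have wx : weight f None = c + sumn (mkseq a n).
  rewrite weight_center f_vert gN; congr (_ + _).
  by rewrite sumn_mkseq; apply: eq_bigr => i _; rewrite f_edge ga.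
have wu_f i : weight f (Some (inl i)) = wu.
  by rewrite weight_middle f_vert !f_edge ga gb ge -(wuE i) //; lia.
have wv_f i : weight f (Some (inr i)) = wv.
  by rewrite weight_leaf f_vert f_edge gd ge addnC wvE.
have f_lat : local_antimagic_total f.
  apply/andP; split=> //; apply/forallP => u; apply/forallP => v.
  apply/implyP; case: u v => [[i|i]|] [[j|j]|] //= _;
    by rewrite ?wx ?wu_f ?wv_f // eq_sym.
apply: leq_trans (chi_lat_le f_lat) _; apply: num_weights_le.
by case=> [[i|i]|]; rewrite ?wx ?wu_f ?wv_f !inE eqxx ?orbT.
Qed.

End Spider.

(** The row of index i lists the labels of x u_i, u_i, u_i v_i and v_i, in this
    order. Balanced means that the centre has the same weight as the leaves. *)
Definition balanced_table (n c wu wv : nat) (t : seq (nat * nat * nat * nat)) :=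
  let row := nth (0, 0, 0, 0) t in
  let a i := (row i).1.1.1 in let b i := (row i).1.1.2 in
  let e i := (row i).1.2 in let d i := (row i).2 in
  [&& uniq (table_labels n c a b e d),
      all (fun k => 0 < k <= 4 * n + 1) (table_labels n c a b e d),
      all (fun i => (a i + b i + e i == wu) && (e i + d i == wv)) (iota 0 n),
      wu != wv & c + sumn (mkseq a n) == wv].

Lemma chi_lat_balanced_table n c wu wv t :
  balanced_table n c wu wv t -> chi_lat (spider2 n) <= 2.
Proof.
case/and5P=> L_uniq L_range /allP rows wu_wv /eqP wx.
have row_i i : i < n -> _ :=
  fun lt_in => rows i (etrans (mem_iota 0 n i) lt_in).
apply: leq_trans (chi_lat_spider_le L_uniq L_range _ _ wu_wv _) _.
- by move=> i /row_i/andP[/eqP].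
- by move=> i /row_i/andP[_ /eqP].
- by rewrite wx.
- by rewrite wx /= !inE eqxx orbT; case: ifP.
Qed.

(** The tables come from a computer search. It starts from the choice of n + 1
    labels, to be used at x, with sum [wv]; the labels that remain must then
    contain enough pairs of sum [wv]. *)
Lemma chi_lat_spider_le2 n : 3 <= n <= 9 -> chi_lat (spider2 n) <= 2.
Proof.
case: n => [|[|[|[|[|[|[|[|[|[|n]]]]]]]]]] // _.
- apply: (@chi_lat_balanced_table 3 2 25 14
    [:: (1, 13, 11, 3); (4, 12, 9, 5); (7, 10, 8, 6)]).
  by vm_compute.
- apply: (@chi_lat_balanced_table 4 3 25 19
    [:: (1, 17, 7, 12); (4, 16, 5, 14); (2, 15, 8, 11);
        (9, 10, 6, 13)]).
  by vm_compute.
- apply: (@chi_lat_balanced_table 5 1 34 23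
    [:: (3, 21, 10, 13); (5, 20, 9, 14); (8, 19, 7, 16);
        (4, 18, 12, 11); (2, 15, 17, 6)]).
  by vm_compute.
- apply: (@chi_lat_balanced_table 6 2 37 28
    [:: (1, 25, 11, 17); (4, 24, 9, 19); (6, 23, 8, 20);
        (5, 22, 10, 18); (3, 21, 13, 15); (7, 14, 16, 12)]).
  by vm_compute.
- apply: (@chi_lat_balanced_table 7 1 46 36
    [:: (5, 29, 12, 24); (8, 28, 10, 26); (4, 20, 22, 14);
        (2, 19, 25, 11); (7, 18, 21, 15); (6, 17, 23, 13);
        (3, 16, 27, 9)]).
  by vm_compute.
- apply: (@chi_lat_balanced_table 8 1 43 45
    [:: (2, 25, 16, 29); (5, 24, 14, 31); (7, 23, 13, 32);
        (9, 22, 12, 33); (3, 21, 19, 26); (8, 20, 15, 30);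
        (4, 11, 28, 17); (6, 10, 27, 18)]).
  by vm_compute.
- apply: (@chi_lat_balanced_table 9 1 52 55
    [:: (5, 28, 19, 36); (7, 27, 18, 37); (2, 17, 33, 22);
        (4, 16, 32, 23); (3, 15, 34, 21); (8, 14, 30, 25);
        (10, 13, 29, 26); (9, 12, 31, 24); (6, 11, 35, 20)]).
  by vm_compute.
Qed.

(** The labels e, d, b fill the intervals [1, n], [n + 1, 2n], [2n + 1, 3n], and
    a together with c fills [3n + 1, 4n + 1]. Setting d = 2n + 1 - e makes
    e + d constant. In the zigzag, a increases by 1 from one leg to the next
    while b decreases by 2, first through one parity class of its interval and
    then through the other one; so a + b decreases by 1 at each step within
    each half, and the two ranges of a + b are adjacent. For odd n this uses n
    consecutive values of a, and c is the last label. For even n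
    consecutive values of a would make the two ranges of a + b overlap in one
    value; skipping the middle value of a between the two halves removes the
    overlap, and c takes the skipped value.
    This gives w(u_i) = 6n + 2 + n./2 and w(v_i) = 2n + 1, while w(x), a sum of
    n + 1 of the largest labels, exceeds both. *)
Lemma chi_lat_spider_le3 n : 3 <= n -> chi_lat (spider2 n) <= 3.
Proof.
move=> n_ge3; pose h := n./2; pose k := uphalf n.
have nE : n = h + k by rewrite /h /k; lia.
have kE : k = h + odd n by rewrite /h /k; lia.
pose c := 3 * n + 1 + (if odd n then n else h).
pose a i := 3 * n + 1 + i + (if i < k then 0 else ~~ odd n).
pose b i := if i < k then 3 * n - 2 * i else 3 * n - 1 - 2 * (i - k).
pose e i := if i < k then (h + i).+1 else (i - k).+1.
pose d i := 2 * n + 1 - e i.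
have a_range i : i < n -> 3 * n + 1 <= a i <= 4 * n + 1.
  by rewrite /a => lt_in; case: ifP; case: (odd n) nE kE => /=; lia.
have c_range : 3 * n + 1 <= c <= 4 * n + 1 by rewrite /c; case: ifP; lia.
have b_range i : i < n -> 2 * n + 1 <= b i <= 3 * n.
  by rewrite /b => lt_in; case: ifP; case: (odd n) nE kE => /=; lia.
have e_range i : i < n -> 1 <= e i <= n by rewrite /e => lt_in; case: ifP; lia.
have d_range i : i < n -> n + 1 <= d i <= 2 * n.
  by move=> lt_in; have := e_range i lt_in; rewrite /d; lia.
have a_neq_c i : i < n -> a i <> c.
  by rewrite /a /c => lt_in; case: (odd n) nE kE => /=; case: ifP; lia.
have a_inj : uniq (mkseq a n).
  apply/mkseq_uniqP => i j; rewrite !inE /a => lt_in lt_jn.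
  by case: (odd n) => /=; do 2 case: ifP; lia.
have b_inj : uniq (mkseq b n).
  apply/mkseq_uniqP => i j; rewrite !inE /b => lt_in lt_jn.
  by case: (odd n) nE kE => /=; do 2 case: ifP; lia.
have e_inj : uniq (mkseq e n).
  apply/mkseq_uniqP => i j; rewrite !inE /e => lt_in lt_jn.
  by do 2 case: ifP; lia.
have d_inj : uniq (mkseq d n).
  apply/mkseq_uniqP => i j i_lt j_lt dij.
  apply: (mkseq_uniqP _ _ e_inj) => //; move: dij; rewrite /d.
  by have := e_range i i_lt; have := e_range j j_lt; lia.
(* Labels of different kinds lie in disjoint intervals, except for a and c,
   which share one and are separated by [a_neq_c]. *)
have memP (x : nat) (s : nat -> nat) :
    x \in mkseq s n -> exists2 i, i < n & x = s i.
  by case/mapP=> i; rewrite mem_iota => /andP[_ i_lt] ->; exists i.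
have notin (s : nat -> nat) (x : nat) :
    (forall i, i < n -> s i <> x) -> (x \in mkseq s n) = false.
  by move=> s_neq; apply/negP => /memP[i /s_neq + xE]; rewrite -xE.
have disj (s t : nat -> nat) : (forall i j, i < n -> j < n -> t i <> s j) ->
    has [in mkseq s n] (mkseq t n) = false.
  move=> st_neq; apply/hasP => -[x /memP[i i_lt ->]] /memP[j j_lt].
  exact: st_neq.
have L_uniq : uniq (table_labels n c a b e d).
  rewrite /table_labels cons_uniq !cat_uniq a_inj b_inj e_inj d_inj.
  rewrite !has_cat !mem_cat !disj ?notin //.
  - by move=> i /d_range; lia.
  - by move=> i /e_range; lia.
  - by move=> i /b_range; lia.
  - by move=> i j /d_range + /e_range; lia.
  - by move=> i j /d_range + /b_range; lia.
  - by move=> i j /e_range + /b_range; lia.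
  - by move=> i j /d_range + /a_range; lia.
  - by move=> i j /e_range + /a_range; lia.
  - by move=> i j /b_range + /a_range; lia.
have L_range : all (fun k => 0 < k <= 4 * n + 1) (table_labels n c a b e d).
  rewrite /table_labels /= !all_cat.
  by repeat (apply/andP; split); try lia; apply/allP => x /memP[i i_lt ->];
     have := a_range i i_lt; have := b_range i i_lt; have := e_range i i_lt;
     have := d_range i i_lt; lia.
apply: leq_trans (chi_lat_spider_le (wu := 6 * n + 2 + h) (wv := 2 * n + 1)
  L_uniq L_range _ _ _ _) _.
- move=> i i_lt; rewrite /a /b /e.
  by case: (odd n) nE kE => /=; case: ifP; lia.
- by move=> i /e_range; rewrite /d; lia.
- by lia.
(* w(x) >= n (3n + 1) >= 9n + 3, and this exceeds w(u_i) = 6n + 2 + h. *)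
- rewrite neq_ltn; apply/orP; left.
  have : n * (3 * n + 1) <= sumn (mkseq a n).
    rewrite sumn_mkseq -[X in X * _]card_ord -sum_nat_const.
    by apply: leq_sum => i _; case/andP: (a_range i (ltn_ord i)).
  have : 3 * (3 * n + 1) <= n * (3 * n + 1) by rewrite leq_mul2r n_ge3 orbT.
  by lia.
- exact: size_undup.
Qed.

(** * Lower bounds *)

(** F t is at least the rank of F t among the values of F, and the ranks sum to
    N (N + 1) / 2 for N = #|T|. The sum of the ranks counts the pairs (s, t)
    with F s <= F t; counted together with the reversed pairs, each pair of
    distinct elements contributes at least once and each diagonal pair twice. *)
Lemma sum_distinct_ge (T : finType) (F : T -> nat) :
  injective F -> (forall t, 0 < F t) -> #|T| * #|T|.+1 <= 2 * \sum_t F t.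
Proof.
move=> F_inj F_gt0.
have F_ge_rank t : \sum_s (F s <= F t) <= F t.
  rewrite -[leqLHS]/(\sum_s if F s <= F t then 1 else 0) -big_mkcond /=.
  rewrite sum1dep_card cardE -(size_map F) -[leqRHS](size_iota 1).
  apply: uniq_leq_size; first by rewrite map_inj_uniq ?enum_uniq.
  move=> _ /mapP[s s_le ->]; move: s_le; rewrite mem_enum inE => s_le.
  by rewrite mem_iota F_gt0 add1n ltnS.
apply: (@leq_trans (2 * \sum_t \sum_s (F s <= F t))); last first.
  by rewrite leq_mul2l; apply: leq_sum => t _; exact: F_ge_rank.
rewrite mul2n -addnn [X in _ + X]exchange_big -big_split /=.
rewrite -sum_nat_const; apply: leq_sum => t _.
rewrite -big_split /= (bigD1 t) //= leqnn.
have -> : #|T| = (\sum_(s | s != t) 1).+1.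
  by rewrite -sum1_card (bigD1 t).
rewrite addSn add1n !ltnS; apply: leq_sum => s _.
by case: (ltngtP (F s) (F t)).
Qed.

Lemma chi_lat_spider_ge2 n : 0 < n -> 2 <= chi_lat (spider2 n).
Proof.
case: n => // n _; apply: chi_lat_ge => f f_lat.
apply: (@num_weights_ge _ f [:: None; Some (inl ord0)]).
by rewrite /= inE andbT; apply: weight_adj.
Qed.

(** With only two weights the centre and all leaves share a weight B, which then
    has to be large, as a sum of n + 1 distinct labels at x, and small, as the
    common value of n disjoint pairs of labels. *)
Lemma chi_lat_spider_ge3 n : 10 <= n -> 3 <= chi_lat (spider2 n).
Proof.
move=> n_ge10; apply: chi_lat_ge => f f_lat.
rewrite leqNgt; apply/negP => f_le2.
have f_inj := label_inj f_lat.
have w_leaf i : weight f (Some (inr i)) = weight f None.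
  apply/eqP/negPn/negP => w_neq; move: f_le2; rewrite ltnNge => /negP; apply.
  apply: (@num_weights_ge _ f [:: None; Some (inl i); Some (inr i)]).
  have xu : weight f None != weight f (Some (inl i)) by exact: weight_adj.
  have uv : weight f (Some (inl i)) != weight f (Some (inr i)).
    by apply: weight_adj; rewrite //= /spider_adj /= eqxx.
  by rewrite /= !inE negb_or xu uv eq_sym w_neq.
set B := weight f None in w_leaf.
have B_ge : n.+1 * n.+2 <= 2 * B.
  pose F (o : option 'I_n) : nat :=
    if o is Some i then f (inr (inner_edge i)) else f (inl None).
  have -> : B = \sum_o F o.
    rewrite (bigD1 None) //= (reindex_omap Some id) => [|[]] //.
    rewrite /B weight_center; congr (_ + _).
    by apply: eq_bigl => i; rewrite eqxx.
  have := @sum_distinct_ge _ F; rewrite card_option card_ord; apply.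
    by move=> [i|] [j|] //= /f_inj // H; have [->] := leg_edge_inj (inr_inj H).
  by case=> [i|] /=; exact: label_gt0.
(* [sum_distinct_ge] bounds sums from below; it is applied to the reflected
   labels 4n + 2 - k of the leaves and outer edges to bound B from above. *)
have B_le : 2 * n * (2 * n).+1 <= 2 * (n * (8 * n + 4 - B)).
  have f_le z : f z <= 4 * n + 1 by rewrite -nlabels_spider -ltnS.
  pose F (s : 'I_n + 'I_n) : nat :=
    4 * n + 2 - (match s with
                 | inl i => f (inl (Some (inr i)))
                 | inr i => f (inr (outer_edge i)) end).
  have -> : n * (8 * n + 4 - B) = \sum_s F s.
    rewrite big_sumType /= -big_split /= -[X in X * _]card_ord -sum_nat_const.
    apply: eq_bigr => i _; rewrite /F /= -(w_leaf i) weight_leaf.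
    have sub_add p q : p <= 4 * n + 1 -> q <= 4 * n + 1 ->
        8 * n + 4 - (p + q) = 4 * n + 2 - p + (4 * n + 2 - q) by lia.
    exact: sub_add.
  have := @sum_distinct_ge _ F.
  rewrite card_sum card_ord (mul2n n) -(addnn n); apply.
    have F_inj z t : 4 * n + 2 - f z = 4 * n + 2 - f t -> z = t.
      move=> zt; apply: f_inj; move: (f_le z) (f_le t) zt => /=.
      by move: (nat_of_ord (f z)) (nat_of_ord (f t)) => p q; lia.
    move=> [i|i] [j|j] /F_inj // H; first by case: H => ->.
    by have [->] := leg_edge_inj (inr_inj H).
  have lt_max m : m <= 4 * n + 1 -> 0 < 4 * n + 2 - m by lia.
  by move=> s; apply: lt_max; case: s => i; exact: f_le.
have B_le' : (2 * n).+1 <= 8 * n + 4 - B.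
  by move: B_le; rewrite mulnA leq_pmul2l //; lia.
by nia.
Qed.

Theorem theorem2p1 (n : nat) (hn : 3 <= n) :
  chi_lat (spider2 n) = if n <= 9 then 2 else 3.
Proof.
apply/eqP; rewrite eqn_leq; case: (leqP n 9) => n9.
  by rewrite chi_lat_spider_le2 ?hn // chi_lat_spider_ge2 //; lia.
by rewrite chi_lat_spider_le3 // chi_lat_spider_ge3.
Qed.
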